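(* Let $\mu$ be a countably additive Borel non-negative measure of bounded variation (i.e. finite) on $\mathbb{R}$. Assume there exists $\sigma\in(0,1)$ such that for every Borel set $A\subset\mathbb{R}$ the Fourier transform of the restricted measure $\mu|_A$ satisfies $$\limsup_{\xi\to\infty}|\widehat{\mu|_A}(\xi)|\le(1-\sigma)\,\|\mu|_A\|.$$ Then the linear flow $\mathbf{\Phi}$ has the following non-transitivity properties: 1. for any $u\in H=L^2(\mathbb{R},\mathcal{B},\mu,\mathbb{C})$ with $|u(x)|>0$ for $\mu$-a.e. $x$, the trajectory $\Gamma_u=\{\mathbf{\Phi}_tu: t\in\mathbb{R}\}$ is not dense in the torus $\mathbb{T}_u$; 2. every point $v\in\mathbb{T}_{|u|}$ (with $u$ as in 1) is wandering for the flow $(\mathbf{\Phi}_tv)(x)=e^{itx}v(x)$, $x\in\mathbb{R}$, $t\in\mathbb{R}$.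
   Context: $\mathcal{B}$ is the $\sigma$-algebra of Borel subsets of $\mathbb{R}$. $\hat\nu(\xi)=\int_{\mathbb{R}}e^{-i\xi x}\,d\nu(x)$ denotes the Fourier transform of a finite Borel measure $\nu$ on $\mathbb{R}$, and $\|\nu\|$ its total variation. For a Borel set $A$, $\mu|_A(B)=\mu(A\cap B)$. The linear flow on $H$ is $(\mathbf{\Phi}_tv)(x)=e^{itx}v(x)$. For $u\in H$, the invariant torus is $\mathbb{T}_u=\mathbb{T}_{|u|}=\{v\in H:|v(x)|=|u(x)|\text{ for }\mu\text{-a.e. }x\}$, with the topology induced from the norm of $H$. A point $v\in H$ is wandering for $\mathbf{\Phi}$ if there exist a neighborhood $O(v)\subset H$ of $v$ and a time $T>0$ such that $\mathbf{\Phi}_t(O(v))\cap O(v)=\emptyset$ for all $t>T$.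
   Formalization: The measure μ is additionally assumed to be nonzero; for μ = 0 the space H is {0}, the single trajectory is dense in its torus and the point is not wandering, so both conclusions fail. *)

(* Defs.v *)
From HB Require Import structures.
From mathcomp Require Import all_boot all_order all_algebra.
From mathcomp Require Import generic_quotient ring_quotient complex.
From mathcomp Require Import all_classical all_reals all_analysis.
From mathcomp Require Import measurable_realfun.
Set Implicit Arguments.
Unset Strict Implicit.
Unset Printing Implicit Defensive.
Import Order.TTheory GRing.Theory Num.Theory.
Import numFieldNormedType.Exports.
Local Open Scope classical_set_scope.
Local Open Scope ring_scope.
Local Open Scope quotient_scope.
Local Open Scope complex_scope.

(* The library's order and norm on R[i] are R[i]-valued; [normc] is the modulus
   as a real number. *)
Notation normc := ComplexField.Normc.normc.

Lemma normc_ge0 (R : rcfType) (z : R[i]) : 0 <= normc z.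
Proof. by case: z => a b; exact: sqrtr_ge0. Qed.

Lemma normcZ (R : rcfType) (a : R) (z : Rcomplex R) :
  normc (a *: z) = `|a| * normc z.
Proof.
case: z => x y /=; rewrite !exprMn -mulrDr sqrtrM ?sqr_ge0//.
by rewrite sqrtr_sqr.
Qed.

Section complex_functions.
Context d (T : measurableType d) (R : realType).
Implicit Types f g : T -> Rcomplex R.

(* Borel measurability for R[i] identified with R^2. *)
Definition cmeasurable f :=
  measurable_fun [set: T] (fun x => complex.Re (f x)) /\
  measurable_fun [set: T] (fun x => complex.Im (f x)).

Lemma cmeasurable_normc f : cmeasurable f ->
  measurable_fun [set: T] (fun x => normc (f x)).
Proof.
move=> [mr mi].
rewrite (_ : (fun x => _) = (@powR R ^~ 2^-1) \o
    (fun x => complex.Re (f x) ^+ 2 + complex.Im (f x) ^+ 2)); last first.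
  apply/funext => x /=; rewrite powR12_sqrt ?addr_ge0 ?sqr_ge0//.
  by case: (f x).
apply: measurableT_comp => //.
by apply: measurable_funD; apply: measurable_funX.
Qed.

Lemma cmeasurableD f g : cmeasurable f -> cmeasurable g ->
  cmeasurable (f + g).
Proof.
move=> [fr fi] [gr gi]; split.
- rewrite (_ : (fun x => _) =
    (fun x => complex.Re (f x)) \+ (fun x => complex.Re (g x))).
    exact: measurable_funD.
  by apply/funext => x /=; rewrite fctE; case: (f x); case: (g x).
- rewrite (_ : (fun x => _) =
    (fun x => complex.Im (f x)) \+ (fun x => complex.Im (g x))).
    exact: measurable_funD.
  by apply/funext => x /=; rewrite fctE; case: (f x); case: (g x).
Qed.

Lemma cmeasurableM f g : cmeasurable f -> cmeasurable g ->
  cmeasurable (fun x => (f x : R[i]) * (g x : R[i])).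
Proof.
move=> [fr fi] [gr gi]; split.
- rewrite (_ : (fun x => _) =
    (fun x => complex.Re (f x) * complex.Re (g x)) \-
    (fun x => complex.Im (f x) * complex.Im (g x))).
    by apply: measurable_funB; apply: measurable_funM.
  by apply/funext => x /=; case: (f x); case: (g x).
- rewrite (_ : (fun x => _) =
    (fun x => complex.Re (f x) * complex.Im (g x)) \+
    (fun x => complex.Im (f x) * complex.Re (g x))).
    by apply: measurable_funD; apply: measurable_funM.
  by apply/funext => x /=; case: (f x); case: (g x).
Qed.

Lemma cmeasurable_cst (z : Rcomplex R) : cmeasurable (fun=> z).
Proof. by split; exact: measurable_cst. Qed.

End complex_functions.

Section L2.
Context d (T : measurableType d) (R : realType).
Variable mu : {measure set T -> \bar R}.

(* The R-module structure on functions comes from the alias [Rcomplex R] of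
   [R[i]]. *)
Definition eL2norm (f : T -> Rcomplex R) : \bar R :=
  'N[mu]_2%:E[(fun x => (normc (f x))%:E)]%E.

Definition inL2 : {pred T -> Rcomplex R} :=
  mem [set f | cmeasurable f /\ (eL2norm f < +oo)%E].

Lemma inL2P f : reflect (cmeasurable f /\ (eL2norm f < +oo)%E) (f \in inL2).
Proof. by apply: (iffP idP) => [/set_mem|?]; [|exact/mem_set]. Qed.

Lemma Lnorm2E (h : T -> R) : 'N[mu]_2%:E[(fun x => (h x)%:E)]%E =
  ((\int[mu]_x (h x ^+ 2)%:E) `^ 2^-1)%E.
Proof.
rewrite unlock; congr (_ `^ _)%E; apply: eq_integral => x _.
by rewrite /= powR_mulrn// real_normK// num_real.
Qed.

Lemma eL2normE f :
  eL2norm f = ((\int[mu]_x (normc (f x) ^+ 2)%:E) `^ 2^-1)%E.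
Proof. exact: Lnorm2E. Qed.

Lemma eL2normD (f g : T -> Rcomplex R) : cmeasurable f -> cmeasurable g ->
  (eL2norm (f + g)%R <= eL2norm f + eL2norm g)%E.
Proof.
move=> mf mg.
have nf := cmeasurable_normc mf; have ng := cmeasurable_normc mg.
have nfg := cmeasurable_normc (cmeasurableD mf mg).
pose h : T -> R := (fun x => normc (f x)) \+ (fun x => normc (g x)).
have hD : ('N[mu]_2%:E[EFin \o h] <= eL2norm f + eL2norm g)%E.
  by apply: minkowski_EFin => //; rewrite ler1n.
apply: (le_trans _ hD).
rewrite eL2normE Lnorm2E gt0_ler_poweR ?invr_ge0//.
- by rewrite in_itv/= leey integral_ge0// => x _; rewrite lee_fin sqr_ge0.
- by rewrite in_itv/= leey integral_ge0// => x _; rewrite lee_fin sqr_ge0.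
apply: ge0_le_integral => //.
- by move=> x _; rewrite lee_fin sqr_ge0.
- by apply/measurable_EFinP; exact: measurable_funX.
- apply/measurable_EFinP; apply: measurable_funX; exact: measurable_funD.
- move=> x _; rewrite lee_fin lerXn2r ?nnegrE ?addr_ge0 ?normc_ge0//.
  exact: le_normcD.
Qed.

Lemma eL2normZ (a : R) (f : T -> Rcomplex R) : cmeasurable f ->
  eL2norm (a *: f)%R = (`|a|%:E * eL2norm f)%E.
Proof.
move=> mf; rewrite !eL2normE.
under eq_integral => x _ do rewrite normcZ exprMn EFinM.
rewrite ge0_integralZl//.
- rewrite poweRM ?lee_fin ?sqr_ge0 ?integral_ge0//.
  - by rewrite poweR_EFin powR12_sqrt ?sqr_ge0// sqrtr_sqr normr_id.
  - by move=> x _; rewrite lee_fin sqr_ge0.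
- by apply/measurable_EFinP; apply: measurable_funX; exact: cmeasurable_normc.
- by move=> x _; rewrite lee_fin sqr_ge0.
Qed.

Lemma eL2norm0 : eL2norm 0 = 0%E.
Proof.
rewrite eL2normE (_ : integral _ _ _ = 0%E) ?poweR0r ?invr_eq0 ?pnatr_eq0//.
by rewrite integral0_eq// => x _; rewrite ComplexField.Normc.normc0 expr0n.
Qed.

Fact inL2_submod_closed : submod_closed inL2.
Proof.
split.
  by apply/inL2P; split; [exact: cmeasurable_cst|rewrite eL2norm0 ltry].
move=> a f g /inL2P[mf ff] /inL2P[mg fg]; apply/inL2P.
have maf : cmeasurable (a *: f).
  case: mf => fr fi; split.
  - rewrite (_ : (fun x => _) = (fun x => a * complex.Re (f x))).
      exact: measurable_funM.
    by apply/funext => x; rewrite fctE; case: (f x).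
  - rewrite (_ : (fun x => _) = (fun x => a * complex.Im (f x))).
      exact: measurable_funM.
    by apply/funext => x; rewrite fctE; case: (f x).
split; first exact: cmeasurableD.
rewrite (le_lt_trans (eL2normD maf mg))// lte_add_pinfty// eL2normZ//.
by rewrite lte_mul_pinfty// lee_fin.
Qed.

HB.instance Definition _ :=
  GRing.isSubmodClosed.Build R (T -> Rcomplex R) inL2 inL2_submod_closed.

Record L2fun := MkL2fun { L2fun_val :> T -> Rcomplex R; _ : L2fun_val \in inL2 }.

HB.instance Definition _ := [isSub for L2fun_val].
HB.instance Definition _ := [Choice of L2fun by <:].
HB.instance Definition _ := [SubChoice_isSubLmodule of L2fun by <:].

Definition L2null : {pred L2fun} :=
  mem [set f : L2fun | \forall x \ae mu, f x = 0].

Lemma L2nullP (f : L2fun) :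
  reflect (\forall x \ae mu, f x = 0) (f \in L2null).
Proof. by apply: (iffP idP) => [/set_mem|?]; [|exact/mem_set]. Qed.

Fact L2null_zmod_closed : zmod_closed L2null.
Proof.
split; first by apply/L2nullP; exact: aeW.
move=> f g /L2nullP f0 /L2nullP g0; apply/L2nullP.
apply: filterS2 f0 g0 => x fx gx.
by rewrite -[LHS]/(f x - g x) fx gx subr0.
Qed.

HB.instance Definition _ :=
  GRing.isZmodClosed.Build L2fun L2null L2null_zmod_closed.

(* A class v : L2 coerces to a function through a chosen representative; every
   statement about v x must therefore be made almost everywhere. *)
Definition L2 : Type := Quotient.quot L2null.

HB.instance Definition _ := GRing.Zmodule.on L2.
HB.instance Definition _ := EqQuotient.on L2.

Definition L2repr (v : L2) : T -> Rcomplex R := L2fun_val (repr v).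
Coercion L2repr : L2 >-> Funclass.

Lemma pi_L2P (f g : L2fun) :
  \pi_L2 f = \pi_L2 g <-> \forall x \ae mu, f x = g x.
Proof.
split.
  move/eqP; rewrite -[_ == _]/(f == g %[mod Quotient.quot L2null]).
  rewrite -Quotient.idealrBE => /L2nullP; apply: filterS => x.
  by rewrite -[LHS]/(f x - g x) => /subr0_eq.
move=> fg; apply/eqP; rewrite -[_ == _]/(f == g %[mod Quotient.quot L2null]).
rewrite -Quotient.idealrBE; apply/L2nullP; apply: filterS fg => x fgx.
by rewrite -[LHS]/(f x - g x) fgx subrr.
Qed.

Lemma L2reprP (f : L2fun) : \forall x \ae mu, (\pi_L2 f : L2) x = f x.
Proof. by apply/pi_L2P; rewrite reprK. Qed.

Lemma L2P (v w : L2) : v = w <-> \forall x \ae mu, v x = w x.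
Proof. by rewrite -[in v = w](reprK v) -[in _ = w](reprK w) pi_L2P. Qed.

Definition L2scale (a : R) (v : L2) : L2 := \pi_L2 (a *: repr v).

Lemma pi_L2Z a (f : L2fun) : L2scale a (\pi_L2 f) = \pi_L2 (a *: f).
Proof.
apply/pi_L2P; apply: filterS (L2reprP f) => x fx.
by rewrite -[LHS]/(a *: (\pi_L2 f : L2) x) fx.
Qed.

Lemma pi_L2D (f g : L2fun) : \pi_L2 f + \pi_L2 g = \pi_L2 (f + g) :> L2.
Proof. exact: (esym (Quotient.pi_add L2null f g)). Qed.

Fact L2scaleA a b v : L2scale a (L2scale b v) = L2scale (a * b) v.
Proof.
by elim/quotW: v => f; rewrite (pi_L2Z b f) (pi_L2Z a) (pi_L2Z _ f) scalerA.
Qed.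

Fact L2scale1 : left_id 1 L2scale.
Proof. by elim/quotW => f; rewrite (pi_L2Z _ f) scale1r. Qed.

Fact L2scaleDr : right_distributive L2scale +%R.
Proof.
move=> a; elim/quotW => f; elim/quotW => g.
by rewrite (pi_L2Z _ f) (pi_L2Z _ g) !pi_L2D (pi_L2Z _ (f + g)) scalerDr.
Qed.

Fact L2scaleDl v : {morph L2scale^~ v : a b / a + b}.
Proof.
move=> a b; elim/quotW: v => f.
by rewrite !(pi_L2Z _ f) pi_L2D scalerDl.
Qed.

(* Only real scalars are declared: this makes the norm of L2 real-valued, and
   the norm topology does not depend on the choice of scalars. *)
HB.instance Definition _ := GRing.Zmodule_isLmodule.Build R L2
  L2scaleA L2scale1 L2scaleDr L2scaleDl.

Definition L2norm (v : L2) : R := fine (eL2norm v).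

Lemma eq_eL2norm (f g : L2fun) :
  (\forall x \ae mu, f x = g x) -> eL2norm f = eL2norm g.
Proof.
have mn (h : L2fun) : measurable_fun [set: T] (fun x => (normc (h x) ^+ 2)%:E).
  apply/measurable_EFinP/measurable_funX/cmeasurable_normc.
  by have /inL2P[] := valP h.
move=> fg; rewrite !eL2normE; congr (_ `^ _)%E.
apply: ae_eq_integral => //; apply: filterS fg => x fgx _.
by rewrite fgx.
Qed.

Lemma L2norm_pi (f : L2fun) : L2norm (\pi_L2 f) = fine (eL2norm f).
Proof. by rewrite /L2norm (eq_eL2norm (L2reprP f)). Qed.

Lemma eL2norm_fin_num (f : L2fun) : eL2norm f \is a fin_num.
Proof.
have /inL2P[_ foo] := valP f.
by rewrite ge0_fin_numE// eL2normE poweR_ge0.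
Qed.

Fact L2norm_triangle v w : L2norm (v + w) <= L2norm v + L2norm w.
Proof.
elim/quotW: v => f; elim/quotW: w => g; rewrite pi_L2D !L2norm_pi.
rewrite -lee_fin EFinD !fineK ?eL2norm_fin_num//.
by have /inL2P[? _] := valP f; have /inL2P[? _] := valP g; exact: eL2normD.
Qed.

Fact L2normZ a v : L2norm (a *: v) = `|a| * L2norm v.
Proof.
elim/quotW: v => f; rewrite -[_ *: _]/(L2scale _ _) (pi_L2Z a f) !L2norm_pi.
have /inL2P[mf _] := valP f.
by rewrite (eL2normZ a mf) fineM ?eL2norm_fin_num.
Qed.

Lemma pi_L20 : \pi_L2 (0 : L2fun) = 0 :> L2.
Proof. by apply: (@addrI L2 (\pi_L2 0)); rewrite pi_L2D !addr0. Qed.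

Fact L2norm_eq0 v : L2norm v = 0 -> v = 0.
Proof.
elim/quotW: v => f; rewrite L2norm_pi => /eqP.
rewrite fine_eq0 ?eL2norm_fin_num// => /eqP.
have /inL2P[/cmeasurable_normc mf _] := valP f.
move=> /Lnorm_eq0_eq0 f0; rewrite -pi_L20; apply/pi_L2P.
have /f0 : measurable_fun [set: T] (fun x => (normc (f x))%:E).
  exact/measurable_EFinP.
have lt02 : (0%R < (2%:R : R)%:E)%E by rewrite lte_fin.
by move=> /(_ lt02); apply: filterS => x /(_ I) [] /ComplexField.Normc.eq0_normc.
Qed.

HB.instance Definition _ := Lmodule_isNormed.Build R L2
  L2norm_triangle L2normZ L2norm_eq0.

End L2.

(* e^{iy}; the library has no complex exponential. *)
Definition expi (R : realType) (y : R) : R[i] := cos y +i* sin y.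

Lemma normc_expi (R : realType) (y : R) : normc (expi y) = 1.
Proof. by rewrite /= cos2Dsin2 sqrtr1. Qed.

Definition cRintegral d (T : measurableType d) (R : realType)
    (nu : {measure set T -> \bar R}) (f : T -> R[i]) : R[i] :=
  (\int[nu]_x complex.Re (f x))%R +i* (\int[nu]_x complex.Im (f x))%R.

Definition fourier (R : realType)
    (nu : {measure set (measurableTypeR R) -> \bar R}) (xi : R) : R[i] :=
  cRintegral nu (fun x => expi (- (xi * x))).

Section tvnorm.
Context d (T : measurableType d) (R : realType).

(* Total variation norm of a set function: supremum of \sum_i |nu(E_i)| over
   the finite measurable partitions (E_i) of T. *)
Definition tvnorm (nu : set T -> \bar R) : \bar R :=
  ereal_sup [set s | exists n (E : 'I_n -> set T),
    [/\ forall i, measurable (E i), trivIset [set: 'I_n] E,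
        \bigcup_i E i = [set: T] & s = (\sum_(i < n) `|nu (E i)|)%E]].

Lemma tvnorm_measure (nu : {measure set T -> \bar R}) :
  tvnorm nu = nu [set: T].
Proof.
have gee0_sum n (E : 'I_n -> set T) :
    (\sum_(i < n) `|nu (E i)| = \sum_(i < n) nu (E i))%E.
  by apply: eq_bigr => i _; rewrite gee0_abs.
apply/eqP; rewrite eq_le; apply/andP; split.
  apply: ge_ereal_sup => _ [n [E [mE tE EU ->]]].
  rewrite gee0_sum -(measure_bigsetU_ord nu xpredT)//.
  by rewrite le_measure ?inE//; exact: bigsetU_measurable.
apply: ereal_sup_ubound; exists 1%N, (fun=> [set: T]); split => //.
- by move=> i j _ _ _; rewrite !ord1.
- by apply/seteqP; split => // x _; exists ord0.
- by rewrite big_ord1 gee0_abs.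
Qed.

End tvnorm.

Definition wandering (R : realType) (M : topologicalType) (F : R -> M -> M)
    (v : M) :=
  exists2 O : set M, nbhs v O &
  exists2 t0 : R, 0 < t0 & forall t, t0 < t -> (F t @` O) `&` O = set0.

Section flow.
Context (R : realType).
Variable mu : {measure set (measurableTypeR R) -> \bar R}.
Local Notation H := (L2 mu).

Fact flow_subproof (t : R) (f : L2fun mu) :
  (fun x => expi (t * x) * f x : Rcomplex R) \in inL2 mu.
Proof.
have /inL2P[mf foo] := valP f; apply/inL2P; split.
  apply: (@cmeasurableM _ _ _ (fun x => expi (t * x))) => //; split.
  - apply: (@measurableT_comp _ _ _ _ _ _ (@cos R) _ ( *%R t)).
      by apply: continuous_measurable_fun; exact: continuous_cos.
    exact: mulrl_measurable.
  - apply: (@measurableT_comp _ _ _ _ _ _ (@sin R) _ ( *%R t)).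
      by apply: continuous_measurable_fun; exact: continuous_sin.
    exact: mulrl_measurable.
rewrite (_ : eL2norm _ _ = eL2norm mu f)// !eL2normE; congr (_ `^ _)%E.
apply: eq_integral => x _.
by rewrite ComplexField.Normc.normcM normc_expi mul1r.
Qed.

Definition flow (t : R) (v : H) : H :=
  \pi_H (MkL2fun (flow_subproof t (repr v))).

Lemma flowE t (v : H) : \forall x \ae mu, flow t v x = expi (t * x) * v x.
Proof. exact: L2reprP. Qed.

Definition torus (u : H) : set H :=
  [set v : H | \forall x \ae mu, normc (v x) = normc (u x)].

Definition trajectory (u : H) : set H := [set flow t u | t in [set: R]].

Lemma trajectory_sub_torus (u : H) : trajectory u `<=` torus u.
Proof.
move=> _ [t _ <-]; apply: filterS (flowE t u) => x ->.
by rewrite ComplexField.Normc.normcM normc_expi mul1r.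
Qed.

End flow.

(* Main.v *)
Require Import Defs.
From mathcomp Require Import all_boot all_order all_algebra.
From mathcomp Require Import complex.
From mathcomp Require Import all_classical all_reals all_analysis.
From mathcomp Require Import measurable_realfun ring lra.
Import Order.TTheory GRing.Theory Num.Theory.
Import numFieldNormedType.Exports.
Local Open Scope classical_set_scope.
Local Open Scope ring_scope.

(** Both parts rest on one estimate. Let |v| > 0 almost everywhere, and let A be
    a set of positive measure on which |v| >= c > 0. Since
    |e^{iy} - 1|^2 = 2 - 2 cos y, with nu the restriction of mu to A,
      |Phi_t v - v|^2 >= c^2 * \int_A (2 - 2 cos (t x)) dmu(x)
                       = c^2 * (2 mu(A) - 2 Re (hat nu (t))),
    and the bound on the limsup of |hat nu| makes the right-hand side at least
    c^2 sigma mu(A) for all large t ([flow_away]). So the orbit of v eventually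
    stays at distance at least some delta > 0 from v.

    Wandering ([flow_away_wandering]): if w and Phi_t w were both within
    delta / 2 of v, then, Phi_t being a linear isometry, Phi_t v would be within
    delta of v.

    Non-density ([flow_away_opp_not_dense]): the point - u of the torus of u is
    not in the closure of the orbit of u. Indeed, if Phi_t u is close to - u,
    then Phi_{2t} u is close to u, and so is Phi_{2Nt} u for any fixed N, the
    error being multiplied by at most 2N. This is absurd as soon as 2Nt is large
    enough for the estimate above to apply. A fixed N serves all t because t is
    bounded away from 0: for small t, Phi_t u is close to u, hence far from - u
    ([flow_away_opp]). Negative t reduce to positive t, since Phi_t u + u and
    u + Phi_{-t} u have the same norm. *)

(** * Moduli and exponentials of modulus 1 *)

Lemma sqr_normc (R : rcfType) (z : R[i]) :
  normc z ^+ 2 = complex.Re z ^+ 2 + complex.Im z ^+ 2.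
Proof. by case: z => a b; rewrite sqr_sqrtr ?addr_ge0 ?sqr_ge0. Qed.

Lemma expiD (R : realType) (x y : R) : expi (x + y) = expi x * expi y.
Proof.
apply/eqP; rewrite eq_complex /= cosD sinD.
by apply/andP; split; apply/eqP; ring.
Qed.

Lemma sqr_normc_expiB1 (R : realType) (y : R) :
  normc (expi y - 1) ^+ 2 = 2 - 2 * cos y.
Proof. by rewrite sqr_normc /=; have := cos2Dsin2 y; nra. Qed.

Lemma sqr_normc_expiD1 (R : realType) (y : R) :
  normc (expi y + 1) ^+ 2 = 2 + 2 * cos y.
Proof. by rewrite sqr_normc /=; have := cos2Dsin2 y; nra. Qed.

(** * Pointwise description of the operations and the norm of L2 *)

Section L2_theory.
Context {d} {T : measurableType d} {R : realType}.
Context {mu : {measure set T -> \bar R}}.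
Implicit Types v w : L2 mu.

Lemma L2addE v w : \forall x \ae mu, (v + w : L2 mu) x = v x + w x.
Proof.
rewrite -[in v + _](reprK v) -[in _ + w](reprK w) pi_L2D.
exact: L2reprP.
Qed.

Lemma L2oppE v : \forall x \ae mu, (- v : L2 mu) x = - v x.
Proof.
have : \forall x \ae mu, (- v + v : L2 mu) x = 0.
  by rewrite addNr -pi_L20; exact: L2reprP.
apply: filterS2 (L2addE (- v) v) => x -> /eqP.
by rewrite addr_eq0 => /eqP.
Qed.

Lemma L2subE v w : \forall x \ae mu, (v - w : L2 mu) x = v x - w x.
Proof. by apply: filterS2 (L2addE v (- w)) (L2oppE w) => x -> ->. Qed.

Lemma L2_cmeasurable v : cmeasurable v.
Proof. by have /inL2P[] := valP (repr v). Qed.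

Lemma measurable_sqr_normc_L2 v :
  measurable_fun [set: T] (fun x => (normc (v x) ^+ 2)%:E).
Proof.
apply/measurable_EFinP/measurable_funX/cmeasurable_normc.
exact: L2_cmeasurable.
Qed.

Lemma L2norm_sqr v : (`|v| ^+ 2)%:E = (\int[mu]_x (normc (v x) ^+ 2)%:E)%E.
Proof.
rewrite -[`|v|]/(L2norm v) EFin_expe /L2norm fineK ?eL2norm_fin_num//.
rewrite eL2normE; set I := (integral _ _ _).
have I0 : (0 <= I)%E by apply: integral_ge0 => x _; rewrite lee_fin sqr_ge0.
by rewrite poweR12_sqrt// sqr_sqrte.
Qed.

Lemma eq_L2norm v w :
  (\forall x \ae mu, normc (v x) = normc (w x)) -> `|v| = `|w|.
Proof.
move=> vw; apply/eqP; rewrite -(@eqrXn2 _ 2)// -eqe !L2norm_sqr; apply/eqP.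
apply: ae_eq_integral => //; try exact: measurable_sqr_normc_L2.
by apply: filterS vw => x -> _.
Qed.

(** The restricted measure is dominated by mu and ignores the complement of A,
    which is why the pointwise bound may be asked on A only. *)
Lemma integral_mrestr_le_L2norm_sqr {v} {A : set T} (mA : measurable A)
    {h : T -> R} : measurable_fun [set: T] h -> (forall x, 0 <= h x) ->
  (\forall x \ae mu, A x -> h x <= normc (v x) ^+ 2) ->
  (\int[mrestr mu mA]_x (h x)%:E <= (`|v| ^+ 2)%:E)%E.
Proof.
move=> mh h0 hv; rewrite L2norm_sqr.
apply: (@le_trans _ _ (\int[mrestr mu mA]_x (normc (v x) ^+ 2)%:E)%E).
  apply: ae_ge0_le_integral => //.
  - by move=> x _; rewrite lee_fin.
  - exact/measurable_EFinP.
  - by move=> x _; rewrite lee_fin sqr_ge0.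
  - exact: measurable_sqr_normc_L2.
  case: hv => N [mN N0 hN].
  exists (N `|` ~` A); split.
  - by apply: measurableU => //; exact: measurableC.
  - rewrite /= /mrestr setIUl setICl setU0.
    apply/eqP; rewrite -measure_le0 -N0.
    by apply: le_measure; rewrite ?inE//; exact: measurableI.
  - move=> x /= hx; have [Ax|] := pselect (A x); [left|by right].
    by apply: hN => /= hx'; apply: hx => _; rewrite lee_fin; exact: hx'.
apply: ge0_le_measure_integral => //.
- move=> S mS; rewrite /= /mrestr.
  by apply: le_measure; rewrite ?inE//; exact: measurableI.
- by move=> x; rewrite lee_fin sqr_ge0.
- exact: measurable_sqr_normc_L2.
Qed.

(** Designed for w = Phi_t v - v and w = Phi_t v + v, where |w x|^2 is the
    product of |v x|^2 and of an explicit trigonometric function of x. *)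
Lemma multiplier_le_L2norm_sqr {v w} {A : set T} (mA : measurable A) {c : R}
    {h : T -> R} : 0 <= c -> measurable_fun [set: T] h ->
  (forall x, 0 <= h x) -> (forall x, A x -> c <= normc (v x)) ->
  (\forall x \ae mu, A x -> h x * normc (v x) ^+ 2 <= normc (w x) ^+ 2) ->
  ((c ^+ 2)%:E * \int[mrestr mu mA]_x (h x)%:E <= (`|w| ^+ 2)%:E)%E.
Proof.
move=> c0 mh h0 cv hvw.
rewrite -ge0_integralZl//; last 3 first.
- exact/measurable_EFinP.
- by move=> x _; rewrite lee_fin.
- by rewrite lee_fin sqr_ge0.
apply: (integral_mrestr_le_L2norm_sqr mA (h := fun x => c ^+ 2 * h x)).
- exact: measurable_funM.
- by move=> x; rewrite mulr_ge0 ?sqr_ge0.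
apply: filterS hvw => x hvw Ax; rewrite (le_trans _ (hvw Ax))// mulrC.
by rewrite ler_wpM2l// lerXn2r ?nnegrE ?normc_ge0 ?cv.
Qed.

End L2_theory.

(** * The flow as a group of linear isometries *)

Section flow_theory.
Context {R : realType} {mu : {measure set (measurableTypeR R) -> \bar R}}.
Implicit Types v w : L2 mu.

Lemma normc_flow t v : \forall x \ae mu, normc (flow t v x) = normc (v x).
Proof.
apply: filterS (flowE t v) => x ->.
by rewrite ComplexField.Normc.normcM normc_expi mul1r.
Qed.

Lemma flowB t v w : flow t (v - w) = flow t v - flow t w.
Proof.
apply/L2P; near=> x.
rewrite (near (flowE t (v - w)) x)// (near (L2subE v w) x)//.
rewrite (near (L2subE (flow t v) (flow t w)) x)//.
by rewrite (near (flowE t v) x)// (near (flowE t w) x)// -mulrBr.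
Unshelve. all: by end_near. Qed.

Lemma flow_comp s t v : flow s (flow t v) = flow (s + t) v.
Proof.
apply/L2P; near=> x.
rewrite (near (flowE s (flow t v)) x)// (near (flowE t v) x)//.
by rewrite (near (flowE (s + t) v) x)// mulrDl expiD mulrA.
Unshelve. all: by end_near. Qed.

Lemma flow0 v : flow 0 v = v.
Proof.
apply/L2P; apply: filterS (flowE 0 v) => x ->.
by rewrite mul0r /expi cos0 sin0 mul1r.
Qed.

Lemma flowN t v : flow t (- v) = - flow t v.
Proof. by rewrite -[- v]sub0r -(subrr v) !flowB subrr sub0r. Qed.

Lemma flowD t v w : flow t (v + w) = flow t v + flow t w.
Proof. by rewrite -[w]opprK flowB flowN !opprK. Qed.

Lemma norm_flow t v : `|flow t v| = `|v|.
Proof. by apply: eq_L2norm; exact: normc_flow. Qed.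

(** Each of the n steps from Phi_{kt} v to Phi_{(k+1)t} v is the image under the
    isometry Phi_{kt} of the step from v to Phi_t v. *)
Lemma norm_flow_nat t v n : `|flow (n%:R * t) v - v| <= n%:R * `|flow t v - v|.
Proof.
elim: n => [|n IHn]; first by rewrite !mul0r flow0 subrr normr0.
rewrite -natr1 !mulrDl !mul1r -flow_comp.
rewrite -(subrKA (flow (n%:R * t) v)) -flowB (le_trans (ler_normD _ _))//.
by rewrite norm_flow addrC lerD.
Qed.

End flow_theory.

(** * Displacement of a point under the flow *)

(** The sets where |v x| >= 1/(n+1) and |x| <= n+1 cover almost all of the line,
    so they cannot all be negligible. The lower bound c controls the norm of
    L2; the bound M makes e^{itx} close to 1 uniformly on A for small t. *)
Lemma large_modulus_set {R : realType}
    {mu : {finite_measure set (measurableTypeR R) -> \bar R}} {v : L2 mu} :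
  mu [set: measurableTypeR R] <> 0%E ->
  (\forall x \ae mu, 0 < normc (v x)) ->
  exists c M : R, exists2 A : set (measurableTypeR R),
  [/\ 0 < c, 0 < M, measurable A & (0 < mu A)%E] &
  forall x, A x -> c <= normc (v x) /\ `|x| <= M.
Proof.
move=> mu_neq0 v_gt0.
pose A (n : nat) : set (measurableTypeR R) :=
  [set x | n.+1%:R^-1 <= normc (v x)] `&` [set x | `|x| <= n.+1%:R].
have mA n : measurable (A n).
  apply: measurableI.
    rewrite -[X in measurable X]setTI.
    have : measurable_fun [set: measurableTypeR R]
        (fun x => n.+1%:R^-1 <= normc (v x)).
      apply: measurable_fun_ler => //.
      by apply: cmeasurable_normc; exact: L2_cmeasurable.
    by move=> /(_ measurableT [set true] I); congr (measurable (_ `&` _)).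
  rewrite -[X in measurable X]setTI.
  have : measurable_fun [set: measurableTypeR R] (fun x : R => `|x| <= n.+1%:R).
    by apply: measurable_fun_ler => //; exact: measurable_normr.
  by move=> /(_ measurableT [set true] I); congr (measurable (_ `&` _)).
have [n An] : exists n, (0 < mu (A n))%E.
  apply: contrapT => /forallNP An0; apply: mu_neq0.
  apply/(negligibleP _ measurableT).
  have : mu.-negligible (\bigcup_n A n).
    apply: negligible_bigcup => n; apply/negligibleP => //.
    apply/eqP; rewrite -measure_le0 leNgt; apply/negP; exact: An0.
  have : mu.-negligible (~` [set x | 0 < normc (v x)]) by exact: v_gt0.
  move=> /[swap] /negligibleU /[apply]; apply: negligibleS => x _.
  have [vx|vx] := ltP 0 (normc (v x)); last first.
    by right => /=; apply/negP; rewrite -leNgt.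
  left; pose n := Num.truncn (Num.max (normc (v x))^-1 `|x|).
  have : Num.max (normc (v x))^-1 `|x| < n.+1%:R by exact: truncnS_gt.
  rewrite gt_max => /andP[vn xn]; exists n => //; split => /=; last exact: ltW.
  by rewrite invf_ple ?posrE// ltW.
exists n.+1%:R^-1, n.+1%:R, (A n); last by move=> x [].
by split; rewrite ?invr_gt0 ?ltr0n.
Qed.

Lemma limf_esup_lt_near {R : realType} {f : R -> \bar R} {a : \bar R} :
  (limf_esup f +oo%R < a)%E -> \forall t \near +oo, (f t < a)%E.
Proof.
move=> /ereal_inf_ltP[_ [V Voo <-] fVa].
apply: filterS Voo => t Vt; apply: le_lt_trans fVa.
by apply: ereal_sup_ubound; exists t.
Qed.

Lemma measurable_cos_mul {R : realType} (t : R) :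
  measurable_fun [set: measurableTypeR R] (fun x => cos (t * x)).
Proof.
apply: (@measurableT_comp _ _ _ _ _ _ (@cos R) _ ( *%R t)).
  by apply: continuous_measurable_fun; exact: continuous_cos.
exact: mulrl_measurable.
Qed.

(** This is the integral of |e^{itx} - 1|^2. *)
Lemma integral_cos_fourier {R : realType}
    (nu : {finite_measure set (measurableTypeR R) -> \bar R}) (t : R) :
  (\int[nu]_x (2 - 2 * cos (t * x))%:E =
   (2 * fine (nu [set: measurableTypeR R])
    - 2 * complex.Re (fourier nu t))%:E)%E.
Proof.
have iC : nu.-integrable setT (EFin \o (fun x : R => cos (t * x))).
  apply: measurable_bounded_integrable => //.
  - by rewrite ltey_eq fin_num_measure.
  - exact: measurable_cos_mul.
  exists 1; split => // M M1 x _; exact: (le_trans (cos_max _) (ltW M1)).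
have i2 : nu.-integrable setT (EFin \o (fun x : R => 2 : R)).
  exact: finite_measure_integrable_cst.
have i2C : nu.-integrable setT (EFin \o (fun x : R => 2 * cos (t * x))).
  exact: (integrableZl measurableT 2 iC).
under [X in _ = (_ - 2 * X)%:E]eq_Rintegral do rewrite /= cosN.
rewrite -RintegralZl// -Rintegral_cst// -RintegralB// /Rintegral fineK//.
by apply: integrable_fin_num => //; exact: (integrableB measurableT i2 i2C).
Qed.

(** On A, |Phi_t v - v|^2 is at least c^2 (2 - 2 cos (t x)). As the Fourier
    transform of the restriction of mu to A is eventually below
    (1 - sigma / 2) mu(A) in modulus, the integral over A is eventually at least
    c^2 sigma mu(A). *)
Lemma flow_away {R : realType}
    {mu : {finite_measure set (measurableTypeR R) -> \bar R}} {sigma : R}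
    {v : L2 mu} :
  mu [set: measurableTypeR R] <> 0%E -> 0 < sigma ->
  (forall (A : set (measurableTypeR R)) (mA : measurable A),
    (limf_esup (fun xi : R => (normc (fourier (mrestr mu mA) xi))%:E) +oo%R
      <= (1 - sigma)%:E * tvnorm (mrestr mu mA))%E) ->
  (\forall x \ae mu, 0 < normc (v x)) ->
  exists2 delta : R, 0 < delta &
  exists2 t0 : R, 0 < t0 & forall t, t0 < t -> delta <= `|flow t v - v|.
Proof.
move=> mu_neq0 sigma_gt0 limsup_fourier v_gt0.
have [c [M [A [c0 _ mA A0] cA]]] := large_modulus_set mu_neq0 v_gt0.
have Aoo : mu A \is a fin_num by exact: fin_num_measure.
pose m := fine (mu A).
have m0 : 0 < m by rewrite fine_gt0// A0 ltey_eq Aoo.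
have nuT : mrestr mu mA [set: measurableTypeR R] = m%:E.
  by rewrite /mrestr setTI fineK.
(* Halving sigma leaves room for a strict inequality, hence for an eventual
   bound. *)
have : (limf_esup (fun xi : R => (normc (fourier (mrestr mu mA) xi))%:E) +oo%R
    < ((1 - sigma / 2) * m)%:E)%E.
  apply: (le_lt_trans (limsup_fourier A mA)).
  rewrite [X in (_ * X)%E](_ : _ = m%:E); last first.
    exact: etrans (tvnorm_measure _) nuT.
  by rewrite -EFinM lte_fin; nra.
move=> /limf_esup_lt_near [t1 [_ ht1]].
exists (c * Num.sqrt (sigma * m)).
  by rewrite mulr_gt0// sqrtr_gt0 mulr_gt0.
exists (Num.max t1 1) => [|t]; first by rewrite lt_max ltr01 orbT.
rewrite gt_max => /andP[/ht1]; rewrite lte_fin => four_t _.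
rewrite -ler_sqr ?nnegrE ?mulr_ge0 ?sqrtr_ge0 ?(ltW c0)//.
rewrite exprMn sqr_sqrtr ?mulr_ge0 ?(ltW sigma_gt0) ?(ltW m0)// -lee_fin.
have Re_le (z : R[i]) : complex.Re z <= normc z.
  case: z => a b /=; rewrite (le_trans (ler_norm _))// -sqrtr_sqr.
  by rewrite ler_wsqrtr// lerDl sqr_ge0.
have hcos x : 0 <= 2 - 2 * cos (t * x) by have := cos_le1 (t * x); lra.
have mcos : measurable_fun [set: measurableTypeR R]
    (fun x => 2 - 2 * cos (t * x)).
  apply: measurable_funB => //; apply: measurable_funM => //.
  exact: measurable_cos_mul.
apply: (le_trans _ (multiplier_le_L2norm_sqr (v := v) mA (ltW c0) mcos hcos
  _ _)).
- rewrite integral_cos_fourier -EFinM lee_fin ler_wpM2l ?sqr_ge0//.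
  set z := complex.Re _; rewrite /= nuT /=.
  have : z < (1 - sigma / 2) * m by exact: le_lt_trans (Re_le _) four_t.
  lra.
- by move=> x /cA[].
near=> x => _; rewrite (near (L2subE (flow t v) v) x)//.
rewrite (near (flowE t v) x)// -{3}[v x](mul1r (v x : R[i])) -mulrBl.
by rewrite ComplexField.Normc.normcM exprMn sqr_normc_expiB1.
Unshelve. all: by end_near. Qed.

(** For |t| <= 1/M and x in A, |t x| <= 1, so that cos (t x) >= 0 and
    |e^{itx} + 1|^2 >= 2. *)
Lemma flow_away_opp {R : realType}
    {mu : {finite_measure set (measurableTypeR R) -> \bar R}} {v : L2 mu} :
  mu [set: measurableTypeR R] <> 0%E ->
  (\forall x \ae mu, 0 < normc (v x)) ->
  exists2 delta : R, 0 < delta &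
  exists2 eta : R, 0 < eta & forall t, `|t| <= eta -> delta <= `|flow t v + v|.
Proof.
move=> mu_neq0 v_gt0.
have [c [M [A [c0 M0 mA A0] cA]]] := large_modulus_set mu_neq0 v_gt0.
have Aoo : mu A \is a fin_num by exact: fin_num_measure.
pose m := fine (mu A).
have m0 : 0 < m by rewrite fine_gt0// A0 ltey_eq Aoo.
exists (c * Num.sqrt (2 * m)); first by rewrite mulr_gt0// sqrtr_gt0 mulr_gt0.
exists M^-1 => [|t tM]; first by rewrite invr_gt0.
rewrite -ler_sqr ?nnegrE ?mulr_ge0 ?sqrtr_ge0 ?(ltW c0)//.
rewrite exprMn sqr_sqrtr ?mulr_ge0 ?(ltW m0)// -lee_fin.
apply: (le_trans _ (multiplier_le_L2norm_sqr (v := v) (h := cst 2) mA (ltW c0)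
  _ _ _ _)) => //.
- rewrite [X in (_ * X)%E](integral_cst _ measurableT 2%:E) /=.
  rewrite /mrestr setTI -(fineK Aoo) -!EFinM.
  exact: lexx.
- by move=> x /cA[].
near=> x => /cA[_ xM]; rewrite (near (L2addE (flow t v) v) x)//.
rewrite (near (flowE t v) x)// -{3}[v x](mul1r (v x : R[i])) -mulrDl.
rewrite ComplexField.Normc.normcM exprMn sqr_normc_expiD1.
rewrite ler_wpM2r ?sqr_ge0// lerDl mulr_ge0// cos_ge0_pihalf// -ler_norml.
apply: (@le_trans _ _ 1); last first.
  by have := @pi_ge2 R; lra.
by rewrite normrM -(mulVf (lt0r_neq0 M0)) ler_pM.
Unshelve. all: by end_near. Qed.

(** * Dynamical consequences *)

(** A return of the ball of radius delta / 2 around v to itself at time t brings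
    Phi_t v within delta of v. *)
Lemma flow_away_wandering {R : realType}
    {mu : {measure set (measurableTypeR R) -> \bar R}} {v : L2 mu}
    {delta t0 : R} :
  0 < delta -> 0 < t0 -> (forall t, t0 < t -> delta <= `|flow t v - v|) ->
  wandering (flow (mu := mu)) v.
Proof.
move=> delta0 t00 away; exists (ball v (delta / 2)).
  by apply: nbhsx_ballx; rewrite divr_gt0.
exists t0 => // t /away vt; apply/seteqP; split => // _ [[w vw <-]].
move: vw; rewrite -!ball_normE /= => vw vtw.
suff : `|flow t v - v| < delta by rewrite ltNge vt.
rewrite -(subrKA (flow t w)) (splitr delta) (le_lt_trans (ler_normD _ _))//.
by rewrite ltrD// -?flowB ?norm_flow// distrC.
Qed.

(** The ball of radius eps around - u misses the orbit of u: a time t >= 0 with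
    |Phi_t u + u| < eps <= delta' satisfies t > eta, hence 2 N t > t0, whereas
    |Phi_{2Nt} u - u| < 2 N eps <= delta. *)
Lemma flow_away_opp_not_dense {R : realType}
    {mu : {measure set (measurableTypeR R) -> \bar R}} {u : L2 mu}
    {delta t0 delta' eta : R} :
  0 < delta -> (forall t, t0 < t -> delta <= `|flow t u - u|) ->
  0 < delta' -> 0 < eta ->
  (forall t, `|t| <= eta -> delta' <= `|flow t u + u|) ->
  ~ dense (set_val @^-1` trajectory u : set (torus u)).
Proof.
move=> delta0 away delta'0 eta0 away_opp.
have Nu_torus : torus u (- u).
  apply: filterS (L2oppE u) => x ->.
  by case: (u x) => a b; rewrite /= !sqrrN.
(* With this N, t > eta forces N * (t + t) > t0. *)
pose N := (Num.truncn (t0 / (eta *+ 2))).+1.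
have Nt0 : t0 < N%:R * (eta *+ 2).
  by rewrite -ltr_pdivrMr ?mulrn_wgt0// truncnS_gt.
pose eps := Num.min delta' (delta / (N%:R *+ 2)).
have eps0 : 0 < eps by rewrite lt_min delta'0 divr_gt0// mulrn_wgt0// ltr0n.
have far t : eps <= `|flow t u + u|.
  (* Applying the isometry of time - t exchanges t and - t in this norm. *)
  wlog t0_ge0 : t / 0 <= t.
    move=> far; have [|t_lt0] := leP 0 t; first exact: far.
    rewrite -(norm_flow (- t)) flowD flow_comp addNr flow0 addrC far//.
    by rewrite oppr_ge0 ltW.
  have [t_eta|eta_t] := leP `|t| eta.
    by rewrite (le_trans _ (away_opp t t_eta))// ge_min lexx.
  have /away : t0 < N%:R * (t + t).
    rewrite (lt_le_trans Nt0)// ler_wpM2l// -mulr2n lerMn2r/= ltW//.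
    by rewrite -(ger0_norm t0_ge0).
  move=> /le_trans /(_ (norm_flow_nat _ _ _)) delta_le.
  have : `|flow (t + t) u - u| <= `|flow t u + u| *+ 2.
    rewrite -flow_comp -(subrKA (- flow t u)) opprK.
    rewrite (le_trans (ler_normD _ _))// -flowD norm_flow -opprD normrN.
    by rewrite mulr2n.
  move=> /(ler_wpM2l (ler0n R N)) /(le_trans delta_le) {}delta_le.
  rewrite ge_min; apply/orP; right.
  by rewrite ler_pdivrMr ?mulrn_wgt0 ?ltr0n// mulrC mulrnAl -mulrnAr.
move=> /(_ (set_val @^-1` ball (- u) eps)) [].
- exists (exist _ (- u) (mem_set Nu_torus)) => /=; exact: ballxx.
- exists (ball (- u) eps) => //; exact: ball_open.
move=> [w wtorus] [/= uw [t _ tw]].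
move: uw; rewrite -ball_normE /= -tw => uw.
by have := far t; rewrite leNgt -normrN opprD addrC uw.
Qed.

Theorem theorem3p6 (R : realType)
    (mu : {finite_measure set (measurableTypeR R) -> \bar R})
    (mu_neq0 : mu [set: measurableTypeR R] <> 0%E)
    (sigma : R) (sigma_gt0 : 0 < sigma) (sigma_lt1 : sigma < 1)
    (limsup_fourier : forall (A : set (measurableTypeR R)) (mA : measurable A),
      (limf_esup (fun xi : R => (normc (fourier (mrestr mu mA) xi))%:E) +oo%R
        <= (1 - sigma)%:E * tvnorm (mrestr mu mA))%E) :
  forall u : L2 mu, (\forall x \ae mu, 0 < normc (u x)) ->
    ~ dense (set_val @^-1` trajectory u : set (torus u)) /\
    (forall v : L2 mu, torus u v -> wandering (flow (mu := mu)) v).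
Proof.
move=> u u_gt0; split.
  have [delta delta0 [t0 _ away]] :=
    flow_away mu_neq0 sigma_gt0 limsup_fourier u_gt0.
  have [delta' delta'0 [eta eta0 away_opp]] := flow_away_opp mu_neq0 u_gt0.
  exact: (flow_away_opp_not_dense delta0 away delta'0 eta0 away_opp).
move=> v uv; have v_gt0 : \forall x \ae mu, 0 < normc (v x).
  by apply: filterS2 uv u_gt0 => x ->.
have [delta delta0 [t0 t00 away]] :=
  flow_away mu_neq0 sigma_gt0 limsup_fourier v_gt0.
exact: flow_away_wandering delta0 t00 away.
Qed.
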